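(* Let $A:[1,\infty]\to[0,\infty]$ be a nondecreasing function (adjuster) satisfying $\int_1^\infty A(x)x^{-2}\,dx\le1$. Let $\mathbf E=(E^S_t)$ be a projectively consistent dynamic intersection $e$-process collection, including its bookkeeping extension $E^\varnothing$. For every finite $S\subseteq\mathcal I$, define $$\widetilde E_t^S:=A\Big(1\vee\sup_{0\le u\le t}E_u^S\Big).$$ Then for nonempty $S$, $\widetilde E^S$ is a time-monotone $e$-process for $H_S$, and the full collection $\widetilde{\mathbf E}=(\widetilde E^S_t)$ is projectively consistent. Consequently, for $\alpha\in(0,1]$, its dynamic closure $(\mathfrak R_{\alpha,t}(\widetilde{\mathbf E}))_{t\ge0}$ is setwise persistent (pointwise on $\Omega$, $\mathfrak R_{\alpha,t}(\widetilde{\mathbf E})\subseteq\mathfrak R_{\alpha,u}(\widetilde{\mathbf E})$ for $t\le u$) and controls simultaneous SupFDR at level $\alpha$: for every $P\in\mathcal M$, $\mathbb E_P[\sup_{t\ge0}\max_{R\in\mathfrak R_{\alpha,t}(\widetilde{\mathbf E})}\mathrm{FDP}_{\mathcal N(P)}(R)]\le\alpha$.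
   Context: Let $(\Omega,\mathcal F,(\mathcal F_t)_{t\in\mathbb N_0})$ be a discrete-time filtered measurable space, $\mathcal M$ a family of probability measures on $(\Omega,\mathcal F)$, $\mathcal I\subseteq\mathbb N$ an index set (finite or infinite), and $H_i\subseteq\mathcal M$, $i\in\mathcal I$, null hypotheses. Put $\mathcal N(P)=\{i\in\mathcal I:P\in H_i\}$ and, for finite $S\subseteq\mathcal I$, $H_S=\bigcap_{i\in S}H_i$ (with $H_\varnothing=\mathcal M$). The active sets $I_t\subseteq\mathcal I$ are deterministic and finite with $I_0\subseteq I_1\subseteq\cdots$ and $\bigcup_t I_t=\mathcal I$. For a finite $R\subseteq\mathcal I$ and any $S\subseteq\mathcal I$, $\mathrm{FDP}_S(R)=|S\cap R|/(|R|\vee 1)$. A nonnegative $(\mathcal F_t)$-adapted process $E=(E_t)_{t\ge0}$ is an $e$-process for $H\subseteq\mathcal M$ if $\mathbb E_P[E_\tau]\le1$ for every $P\in H$ and every $(\mathcal F_t)$-stopping time $\tau$ with $P(\tau<\infty)=1$. A dynamic intersection $e$-process collection is a family $\mathbf E=(E^S_t)_{t\ge0,\ S\subseteq\mathcal I,\ 0<|S|<\infty}$ such that $E^S$ is an $e$-process for $H_S$ for each nonempty finite $S$. It is projectively consistent if it can be extended to the empty index set by an adapted bookkeeping process $E^\varnothing$ such that, pointwise on $\Omega$, $E^S_t=E^{S\cap I_t}_t$ for every finite $S$ and every $t$. A process $E^S$ is time-monotone if, pointwise on $\Omega$, $E^S_t\le E^S_u$ for all $t\le u$. The closure family at time $t$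 is $\mathfrak R_{\alpha,t}(\mathbf E)=\{R\subseteq I_t:\ \mathrm{FDP}_S(R)\le\alpha E^S_t\text{ for every nonempty }S\subseteq I_t\}$. *)

(* Defs.v *)
From HB Require Import structures.
From mathcomp Require Import all_boot all_order all_algebra finmap.
From mathcomp Require Import all_classical all_reals all_analysis.
From mathcomp Require Import measurable_realfun.

Set Implicit Arguments.
Unset Strict Implicit.
Unset Printing Implicit Defensive.

Import Order.TTheory GRing.Theory Num.Theory.
Import numFieldNormedType.Exports.

Local Open Scope classical_set_scope.
Local Open Scope ring_scope.
Local Open Scope ereal_scope.

Section Processes.
Context {d : measure_display} {T : measurableType d} {R : realType}.

Definition filtration (F : nat -> set (set T)) : Prop :=
  [/\ forall t, sigma_algebra setT (F t),
      forall t, F t `<=` measurable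
    & forall t u, (t <= u)%N -> F t `<=` F u].

(* Processes take values in the extended reals, since an adjuster may take the
   value +oo. *)
Definition adapted (F : nat -> set (set T)) (X : nat -> T -> \bar R) : Prop :=
  forall t (B : set (\bar R)), measurable B -> F t (X t @^-1` B).

(* [None] stands for the infinite time. *)
Definition stopping_time (F : nat -> set (set T)) (tau : T -> option nat)
  : Prop :=
  forall t, F t [set w | exists2 s, (s <= t)%N & tau w = Some s].

(* The value 0 on {tau = oo} is a convention; this event is null wherever
   [stopped] is integrated. *)
Definition stopped (X : nat -> T -> \bar R) (tau : T -> option nat) (w : T)
  : \bar R :=
  if tau w is Some t then X t w else 0.

Definition e_process (F : nat -> set (set T)) (H : set (probability T R))
    (X : nat -> T -> \bar R) : Prop :=
  [/\ forall t w, 0 <= X t w,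
      adapted F X
    & forall P : probability T R, H P ->
      forall tau, stopping_time F tau -> P [set w | tau w <> None] = 1 ->
      \int[P]_w stopped X tau w <= 1].

Definition time_monotone (X : nat -> T -> \bar R) : Prop :=
  forall t u w, (t <= u)%N -> X t w <= X u w.

Definition hyp_inter (M : set (probability T R))
    (H : nat -> set (probability T R)) (S : {fset nat})
  : set (probability T R) :=
  M `&` \bigcap_(i in [set` S]) H i.

Definition true_nulls (I : set nat) (H : nat -> set (probability T R))
    (P : probability T R) : set nat :=
  [set i | I i /\ H i P].

Definition intersection_e_collection (F : nat -> set (set T))
    (M : set (probability T R)) (I : set nat)
    (H : nat -> set (probability T R))
    (E : {fset nat} -> nat -> T -> \bar R) : Prop :=
  forall S : {fset nat}, S != fset0 -> [set` S] `<=` I ->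
    e_process F (hyp_inter M H S) (E S).

(* [E fset0] is the bookkeeping process: it is required to be adapted, but
   neither to be nonnegative nor to be an e-process. *)
Definition projectively_consistent (F : nat -> set (set T)) (I : set nat)
    (Iact : nat -> {fset nat}) (E : {fset nat} -> nat -> T -> \bar R) : Prop :=
  adapted F (E fset0) /\
  forall S : {fset nat}, [set` S] `<=` I ->
    forall t w, E S t w = E (S `&` Iact t)%fset t w.

(* Only the values of [A] on [1, +oo] matter. *)
Definition adjuster (A : \bar R -> \bar R) : Prop :=
  [/\ forall x, 1 <= x -> 0 <= A x,
      forall x y, 1 <= x -> x <= y -> A x <= A y
    & \int[lebesgue_measure]_(x in `[1%R, +oo[) (A x%:E * (x ^- 2)%:E) <= 1].

Definition adjusted (A : \bar R -> \bar R)
    (E : {fset nat} -> nat -> T -> \bar R) (S : {fset nat}) (t : nat) (w : T)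
  : \bar R :=
  A (maxe 1 (ereal_sup [set E S u w | u in [set u | (u <= t)%N]])).

Definition FDP (S : set nat) (Q : {fset nat}) : R :=
  (#|` [fset i in Q | i \in S]%fset|%:R / (maxn #|` Q| 1)%:R)%R.

Definition closure_family (alpha : R) (Iact : nat -> {fset nat})
    (E : {fset nat} -> nat -> T -> \bar R) (t : nat) (w : T)
  : set {fset nat} :=
  [set Q | (Q `<=` Iact t)%fset /\
    forall S : {fset nat}, S != fset0 -> (S `<=` Iact t)%fset ->
      (FDP [set` S] Q)%:E <= alpha%:E * E S t w].

Definition setwise_persistent (C : nat -> T -> set {fset nat}) : Prop :=
  forall t u w, (t <= u)%N -> C t w `<=` C u w.

(* For [C] a closure family of a nonnegative collection, the inner supremum is
   a maximum: it ranges over a finite set, nonempty because it contains the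
   value at the empty rejection set. *)
Definition sup_FDP (N : set nat) (C : nat -> T -> set {fset nat}) (w : T)
  : \bar R :=
  ereal_sup [set ereal_sup [set (FDP N Q)%:E | Q in C t w] | t in [set: nat]].

(* Measurability is part of the claim that the expectation is bounded: the
   library integral is defined even for nonmeasurable functions. *)
Definition controls_SupFDR (M : set (probability T R)) (I : set nat)
    (H : nat -> set (probability T R)) (alpha : R)
    (C : nat -> T -> set {fset nat}) : Prop :=
  forall P : probability T R, M P ->
    measurable_fun setT (sup_FDP (true_nulls I H P) C) /\
    \int[P]_w sup_FDP (true_nulls I H P) C w <= alpha%:E.

End Processes.

(* Main.v *)
Require Import Defs.
From HB Require Import structures.
From mathcomp Require Import all_boot all_order all_algebra finmap.
From mathcomp Require Import all_classical all_reals all_analysis.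
From mathcomp Require Import measurable_realfun.

Set Implicit Arguments.
Unset Strict Implicit.
Unset Printing Implicit Defensive.

Import Order.TTheory GRing.Theory Num.Theory.
Import numFieldNormedType.Exports.

Local Open Scope classical_set_scope.
Local Open Scope ring_scope.

(** Everything rests on one inequality: if [X] is an e-process for [P], then
    [E_P[A(1 v sup_t X_t)] <= 1].

    Stopping [X] when it first exceeds a level [x], and at a deterministic time
    at the latest, gives Ville's inequality [P(sup_t X_t > x) <= 1/x]
    ([ville]). So [Z = 1 v sup_t X_t] is stochastically smaller than the Pareto
    law with density [x^-2] on [1, oo[, and a nondecreasing [A] has a smaller
    mean under [Z] than under that law; the adjuster condition says that the
    latter mean is at most 1 ([pareto_dominated_integral]). The comparison goes
    through level sets: both means are integrals over [y >= 0] of the mass of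
    [{A > y}] ([layer_cake]), and these level sets are upper sets. At any
    stopping time the adjusted process lies below [A(Z)], so it is an e-process
    ([e_process_adjusted]); it is time-monotone because it is a monotone
    function of a running maximum.

    Projective consistency survives the adjustment because for [u <= t] the
    sets [S] and [S n I_t] have the same trace on [I_u], so that [E^S] and
    [E^(S n I_t)] agree up to time [t].

    The two claims about closures hold for every nonnegative, time-monotone,
    projectively consistent collection. For [R] within [I_t], passing from [S]
    to [S n I_t] changes neither [FDP_S(R)] nor the e-value at time [t], and
    the e-value can only grow afterwards: this is persistence
    ([setwise_persistent_closure]). For [SupFDR], testing a member [R] of the
    closure against [S = N(P) n I_t] bounds its [FDP] by [alpha] times
    [f_t = E^(N(P) n I_t)_t]. By consistency and monotonicity [f_t] is
    nondecreasing in [t], and each [f_t] has mean at most 1, so monotone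
    convergence bounds the mean of [sup_t f_t] by 1
    ([controls_SupFDR_closure]). Stopping a changing family of processes is
    thereby avoided: only deterministic times are used here. *)

(** * Integrals of monotone functions *)

Section integration.
Local Open Scope ereal_scope.
Context d (T : measurableType d) (R : realType).

(** The integral of a nonnegative function is a supremum over the simple
    functions below it, so it is monotone without any measurability. This
    saves proving that stopped processes and tail integrals are measurable. *)
Lemma ge0_le_integral_lower (mu : {measure set T -> \bar R}) (D : set T)
    (f g : T -> \bar R) :
  (forall x, D x -> 0 <= f x) -> (forall x, D x -> f x <= g x) ->
  \int[mu]_(x in D) f x <= \int[mu]_(x in D) g x.
Proof.
move=> f0 fg.
have g0 x : D x -> 0 <= g x by move=> Dx; exact: le_trans (f0 _ Dx) (fg _ Dx).
rewrite !ge0_integralE//; apply: le_ereal_sup => _ [h hf <-].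
by exists h => // x; apply: le_trans (hf x) _; exact: lee_restrict.
Qed.

(** The preimage of an upper set is an upper set, and an upper set of the
    extended reals is a half-line starting at its infimum. *)
Lemma nondecreasing_emeasurable (g : \bar R -> \bar R) :
  {homo g : x y / x <= y} -> measurable_fun setT g.
Proof.
move=> g_nd mT; apply: (measurability _ (ErealGenOInfty.measurableE R)) => //.
move=> _ [_ [r ->] <-]; rewrite setTI.
set J := g @^-1` _.
have Jup x y : x <= y -> J x -> J y.
  rewrite /J/= !in_itv/= !andbT => xy rx; exact: lt_le_trans rx (g_nd _ _ xy).
have [Ja|Ja] := pselect (J (ereal_inf J)).
  rewrite [X in measurable X](_ : _ = [set` `[ereal_inf J, +oo[]).
    exact: emeasurable_itv.
  apply/seteqP; split=> x /=; rewrite in_itv/= andbT.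
    by move=> Jx; exact: ereal_inf_lbound.
  by move=> /Jup; exact.
rewrite [X in measurable X](_ : _ = [set` `]ereal_inf J, +oo[]).
  exact: emeasurable_itv.
apply/seteqP; split=> x /=; rewrite in_itv/= andbT.
  move=> Jx; rewrite lt_neqAle ereal_inf_lbound// andbT.
  by apply/eqP => aE; apply: Ja; rewrite aE.
by move=> /ereal_inf_lt[y Jy /ltW/Jup]; exact.
Qed.

(** Tonelli for the region [0 <= y < f x] under the graph of [f]. The weight
    [h] makes the formula apply to a law given by a density. *)
Lemma layer_cake (mu : {sigma_finite_measure set T -> \bar R})
    (f h : T -> \bar R) :
  measurable_fun setT f -> measurable_fun setT h ->
  (forall x, 0 <= f x) -> (forall x, 0 <= h x) ->
  \int[mu]_x (f x * h x) =
  \int[lebesgue_measure]_(y in `[0%R, +oo[)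
    \int[mu]_(x in [set x | y%:E < f x]) h x.
Proof.
move=> mf mh f0 h0.
pose S : set (T * measurableTypeR R) :=
  [set p | (0 <= p.2)%R] `&` [set p | p.2%:E < f p.1].
have mS : measurable S.
  apply: measurableI.
    have : measurable_fun setT (fun p : T * measurableTypeR R => (0 <= p.2)%R).
      exact: measurable_fun_ler.
    by move=> /(_ measurableT [set true]); rewrite setTI; exact.
  have : measurable_fun setT (fun p : T * measurableTypeR R => p.2%:E < f p.1).
    apply: measurable_fun_lte; first exact/measurable_EFinP.
    exact: measurableT_comp.
  by move=> /(_ measurableT [set true]); rewrite setTI; exact.
pose k (p : T * measurableTypeR R) := (\1_S p)%:E * h p.1.
have mk : measurable_fun setT k.
  apply: emeasurable_funM; first exact/measurable_EFinP/measurable_indic.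
  exact: measurableT_comp.
have k0 p : 0 <= k p by rewrite mule_ge0// lee_fin.
have indicS x y : \1_S (x, y) = \1_(xsection S x) y :> R.
  by rewrite !indicE mem_xsection.
have fE x : f x = \int[lebesgue_measure]_y (\1_S (x, y))%:E.
  under eq_integral do rewrite indicS.
  rewrite integral_indic ?setIT//; last exact: measurable_xsection.
  have -> : xsection S x = [set y | (0 <= y)%R /\ y%:E < f x].
    by apply/seteqP; split => y; rewrite xsectionP.
  have := f0 x; case: (f x) => [r| |] // r0.
    rewrite (_ : [set y | _] = `[0%R, r[%classic); last first.
      by apply/seteqP; split => y /=; rewrite in_itv/= lte_fin => /andP.
    apply/esym; apply: (etrans (lebesgue_measure_itv `[0%R, r[)) => /=.
    by move: r0; rewrite lte_fin lee_fin sube0; case: ltgtP => // <-.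
  rewrite (_ : [set y | _] = `[0%R, +oo[%classic); last first.
    by apply/seteqP; split => y /=; rewrite in_itv/= ?andbT ltry// => -[].
  apply/esym; apply: (etrans (lebesgue_measure_itv `[0%R, +oo[)) => /=.
  by rewrite ltry.
have kE x : f x * h x = \int[lebesgue_measure]_y k (x, y).
  rewrite fE -ge0_integralZr//.
  apply/measurable_EFinP; under eq_fun do rewrite indicS.
  exact/measurable_indic/measurable_xsection.
under eq_integral do rewrite kE.
rewrite (fubini_tonelli k)// [RHS]integral_mkcond.
apply: eq_integral => y _; rewrite patchE mem_setE in_itv/= andbT.
have [y0|y0] := leP 0%R y; last first.
  apply: integral0_eq => x _; rewrite /k/= indicE memNset ?mul0e// => -[]/=.
  by rewrite leNgt y0.
rewrite [RHS]integral_mkcond; apply: eq_integral => x _.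
rewrite /k/= indicE patchE; have [yf|yf] := boolP (x \in _).
  by rewrite mem_set ?mul1e//; split => //=; exact: set_mem yf.
by rewrite memNset ?mul0e// => -[_ /= /mem_set]; apply/negP.
Qed.

End integration.

(** * Domination by the Pareto law *)

Lemma continuous_invsqr (R : realType) (a : R) : 0 < a ->
  {within `[a, +oo[, continuous (fun x : R => x ^- 2)}.
Proof.
move=> a0.
have cf (x : R) : a <= x -> {for x, continuous (fun y : R => y ^- 2)}.
  move=> ax; apply: cvgV; last exact: exprn_continuous.
  by rewrite expf_neq0// gt_eqF// (lt_le_trans a0).
apply/continuous_within_itvcyP; split; last exact/cvg_at_right_filter/cf.
by move=> x; rewrite in_itv/= andbT => /ltW; exact: cf.
Qed.

Lemma integral_invsqr_tail (R : realType) (a : R) : 0 < a ->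
  (\int[lebesgue_measure]_(x in `[a, +oo[) (x ^- 2)%:E = (a^-1)%:E)%E.
Proof.
move=> a0.
have x0 (x : R) : a <= x -> 0 < x by exact: lt_le_trans.
have dF (x : R) : 0 < x -> is_derive x 1 (fun y : R => - y^-1) (x ^- 2).
  move=> xp.
  have xn0 : x != 0 by rewrite gt_eqF.
  apply: (is_derive_eq (is_deriveN (is_deriveV _ (is_derive_id x 1)))) => //.
  by rewrite scaleNr opprK /GRing.scale/= mulr1.
have cF (x : R) : 0 < x -> {for x, continuous (fun y : R => - y^-1)}.
  move=> xp; apply: differentiable_continuous; apply/derivable1_diffP.
  exact: (@ex_derive _ _ _ _ _ _ _ (dF _ xp)).
rewrite (@ge0_continuous_FTC2y _ _ (fun x => - x^-1) _ 0).
- by rewrite EFinN oppeK add0e.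
- by move=> x /x0 xp; rewrite invr_ge0 exprn_ge0// ltW.
- exact: continuous_invsqr.
- rewrite -[X in _ --> X]oppr0; apply: cvgN.
  apply/cvgr0Pnorm_lt => e e0; near=> x.
  have xe : e^-1 < x by near: x; apply: nbhs_pinfty_gt; exact: num_real.
  have xp : 0 < x by rewrite (lt_trans _ xe)// invr_gt0.
  by rewrite ger0_norm ?invr_ge0 ?(ltW xp)// invf_plt.
- by move=> x /ltW/x0/dF/@ex_derive.
- exact/cvg_at_right_filter/cF.
- move=> x; rewrite in_itv/= andbT => /ltW/x0 xp.
  by rewrite derive1E; have /@derive_val := dF _ xp.
Unshelve. all: by end_near. Qed.

(** By [layer_cake] it suffices to compare, at each level [y], the
    probability [p] of [{g(Z) > y}] with the Pareto mass [I] of [{g > y}]. If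
    [I < q < p], then [P(Z > 1/q) <= q < p] yields a point where [g(Z) > y]
    although [Z <= 1/q]; by monotonicity [g > y] on [1/q, oo[, whose Pareto
    mass is [q], contradicting [I < q]. *)
Lemma pareto_dominated_integral d (T : measurableType d) (R : realType)
    (P : probability T R) (Z : T -> \bar R) (g : \bar R -> \bar R) :
  {homo g : x y / (x <= y)%E} -> (forall x, 0 <= g x)%E ->
  measurable_fun setT Z -> (forall w, 1 <= Z w)%E ->
  (forall x : R, 1 <= x -> (P [set w | (x%:E < Z w)%E] <= (x^-1)%:E)%E) ->
  (\int[P]_w g (Z w) <=
   \int[lebesgue_measure]_(x in `[1%R, +oo[) (g x%:E * (x ^- 2)%:E))%E.
Proof.
move=> g_nd g0 mZ Z1 tail.
have mg := nondecreasing_emeasurable g_nd.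
have mgZ : measurable_fun setT (g \o Z) by exact: measurableT_comp.
have mgE : measurable_fun setT (fun x : R => g x%:E).
  exact: (measurableT_comp mg).
pose D : set R := `[1%R, +oo[%classic.
pose h := (fun x : R => (x ^- 2)%:E : \bar R) \_ D.
have h0 x : (0 <= h x)%E.
  by apply: erestrict_ge0 => y _; rewrite lee_fin invr_ge0 exprn_even_ge0.
have mh : measurable_fun setT h.
  have mD : measurable D by exact: measurable_itv.
  rewrite /h -measurable_restrictT//; apply/measurable_EFinP.
  exact: (subspace_continuous_measurable_fun mD (continuous_invsqr ltr01)).
have -> : (\int[P]_w g (Z w) = \int[P]_w (g (Z w) * cst 1%E w))%E.
  by apply: eq_integral => w _; rewrite mule1.
have -> : (\int[lebesgue_measure]_(x in D) (g x%:E * (x ^- 2)%:E) =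
    \int[lebesgue_measure]_x (g x%:E * h x))%E.
  rewrite integral_mkcond; apply: eq_integral => x _.
  by rewrite /h !patchE; case: ifP => //; rewrite mule0.
rewrite !layer_cake//.
apply: ge0_le_integral_lower => [y _|y _].
  by apply: integral_ge0.
have mB : measurable [set w | (y%:E < g (Z w))%E].
  rewrite -[X in measurable X]setTI; exact: emeasurable_fun_o_infty.
rewrite integral_cst// mul1e.
have mJ : measurable [set x : R | (y%:E < g x%:E)%E].
  rewrite -[X in measurable X]setTI; exact: emeasurable_fun_o_infty.
set I := (X in (_ <= X)%E); set p := (X in (X <= _)%E).
have I0 : (0 <= I)%E by exact: integral_ge0.
rewrite leNgt; apply/negP => Ip.
have p1 : (p <= 1)%E by exact: probability_le1.
have pfin : p \is a fin_num by exact: fin_num_measure.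
have Ifin : I \is a fin_num.
  by rewrite ge0_fin_numE// (lt_trans Ip)// ltey_eq pfin.
have [Iq qp] :
    fine I < (fine I + fine p) / 2 /\ (fine I + fine p) / 2 < fine p.
  by rewrite !midf_lt// -lte_fin !fineK.
set q := ((_ + _) / 2) in Iq qp.
have q0 : 0 < q by rewrite (le_lt_trans _ Iq)// fine_ge0.
have q1 : q <= 1 by rewrite (le_trans (ltW qp))// -lee_fin fineK.
have b1 : 1 <= q^-1 by rewrite invf_ge1.
have /nonsubset :
    ~ [set w | (y%:E < g (Z w))%E] `<=` [set w | (q^-1%:E < Z w)%E].
  move=> sub; have : (p <= q%:E)%E.
    rewrite -[q in leRHS]invrK; apply: le_trans (tail _ b1).
    apply: le_measure => //; rewrite inE//.
    rewrite -[X in measurable X]setTI; exact: emeasurable_fun_o_infty.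
  by rewrite leNgt -[X in (_ < X)%E]fineK// lte_fin qp.
move=> [w [/= ygZ /negP]]; rewrite -leNgt => /g_nd gZb.
have : (q%:E <= I)%E; last first.
  by rewrite leNgt -[X in (X < _)%E]fineK// lte_fin Iq.
rewrite -[q]invrK -integral_invsqr_tail ?invr_gt0//.
rewrite /I [leLHS]integral_mkcond [leRHS]integral_mkcond.
apply: ge0_le_integral_lower => x _.
  by apply: erestrict_ge0 => z _; rewrite lee_fin invr_ge0 exprn_even_ge0.
rewrite patchE mem_setE in_itv/= andbT; case: ifPn => [bx|_]; last first.
  exact: erestrict_ge0.
rewrite patchE ifT; last first.
  rewrite inE/=; apply: lt_le_trans ygZ (le_trans gZb _); apply: g_nd.
  by rewrite lee_fin.
by rewrite /h patchE ifT// inE /D/= in_itv/= andbT (le_trans b1).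
Qed.

(** * Filtrations and Ville's inequality *)

Lemma measurable_ereal_sup d (T : measurableType d) (R : realType)
    (X : nat -> T -> \bar R) (D : set nat) :
  (forall u, D u -> measurable_fun setT (X u)) ->
  measurable_fun setT (fun w => ereal_sup [set X u w | u in D]).
Proof.
move=> mX mT; apply: (measurability _ (ErealGenOInfty.measurableE R)) => //.
move=> _ [_ [r ->] <-]; rewrite setTI.
rewrite (_ : _ @^-1` _ = \bigcup_(u in D) [set w | (r%:E < X u w)%E]).
  apply: bigcup_measurable => u Du.
  rewrite -[X in measurable X]setTI; apply: emeasurable_fun_o_infty => //.
  exact: mX.
apply/seteqP; split => w /=; rewrite in_itv/= andbT.
  by move=> /ereal_sup_gt[_ [u Du <-] ru]; exists u.
move=> [u Du /= ru]; apply: lt_le_trans ru _.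
by apply: ereal_sup_ubound; exists u.
Qed.

Lemma find_iota_lt (a : pred nat) n :
  (find a (iota 0 n) < n)%N -> a (find a (iota 0 n)).
Proof.
move=> fn; have := @nth_find _ 0%N a (iota 0 n).
by rewrite has_find size_iota nth_iota// add0n; exact.
Qed.

Lemma find_iota_le (a : pred nat) n s :
  (s < n)%N -> a s -> (find a (iota 0 n) <= s)%N.
Proof.
move=> sn as_; rewrite leqNgt; apply/negP => /(before_find 0%N).
by rewrite nth_iota// add0n as_.
Qed.

Section processes.
Local Open Scope ereal_scope.
Context d (T : measurableType d) (R : realType).
Variable F : nat -> set (set T).
Hypothesis hF : filtration F.

(** Turns adaptedness into measurability for the structure generated by
    [F t], so that closure properties of measurable functions apply. *)
Lemma filtration_measurableE t (A : set T) :
  F t A = measurable (A : set (g_sigma_algebraType (F t))).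
Proof.
have [/(_ t) sF _ _] := hF.
by rewrite [RHS]/measurable/= sigma_algebra_id.
Qed.

Lemma adapted_measurable (X : nat -> T -> \bar R) :
  adapted F X -> forall t, measurable_fun setT (X t).
Proof.
by move=> aX t _ B mB; rewrite setTI; have [_ + _] := hF; apply; exact: aX.
Qed.

Lemma adapted_measurable_le (X : nat -> T -> \bar R) : adapted F X ->
  forall u t, (u <= t)%N ->
  measurable_fun setT (X u : g_sigma_algebraType (F t) -> \bar R).
Proof.
move=> aX u t ut _ B mB; rewrite setTI -filtration_measurableE.
by have [_ _ +] := hF; apply; [exact: ut|exact: aX].
Qed.

(** Truncated at [n], since only stopping times that are almost surely finite
    may be used to stop an e-process: [find] returns [n] when no time below
    [n] crosses the level. *)
Definition first_crossing (X : nat -> T -> \bar R) (x : R) n (w : T) :=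
  Some (find (fun t => x%:E < X t w) (iota 0 n)).

Lemma stopping_time_first_crossing (X : nat -> T -> \bar R) x n :
  adapted F X -> stopping_time F (first_crossing X x n).
Proof.
move=> aX t; rewrite /first_crossing.
have [nt|tn] := leqP n t.
  rewrite (_ : [set w | _] = setT) ?filtration_measurableE.
    exact: measurableT.
  apply/seteqP; split => // w _ /=; eexists; last reflexivity.
  by rewrite (leq_trans (find_size _ _))// size_iota.
rewrite (_ : [set w | _] =
    \bigcup_(s in [set s | (s <= t)%N]) [set w | x%:E < X s w]); last first.
  apply/seteqP; split => w /=.
    move=> [s st [sE]]; exists s => //=; rewrite -sE.
    apply: (@find_iota_lt (fun u => x%:E < X u w) n).
    by rewrite sE (leq_ltn_trans st).
  move=> [s /= st xs]; eexists; last reflexivity.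
  by rewrite (leq_trans _ st)// find_iota_le// (leq_ltn_trans st).
rewrite filtration_measurableE; apply: bigcup_measurable => s /= st.
rewrite -[X in measurable X]setTI; apply: emeasurable_fun_o_infty => //.
exact: adapted_measurable_le st.
Qed.

(** Markov's inequality at the truncated crossing time bounds the probability
    of a crossing before [n]; then let [n] tend to infinity. *)
Lemma ville (P : probability T R) (X : nat -> T -> \bar R) (x : R) :
  adapted F X -> (forall t w, 0 <= X t w) ->
  (forall tau, stopping_time F tau -> P [set w | tau w <> None] = 1 ->
     \int[P]_w stopped X tau w <= 1) ->
  (0 < x)%R -> P [set w | exists t, x%:E < X t w] <= (x^-1)%:E.
Proof.
move=> aX X0 hX x0.
pose G n := \bigcup_(t in [set t | (t < n)%N]) [set w | x%:E < X t w].
have mG n : measurable (G n).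
  apply: bigcup_measurable => t _.
  rewrite -[X in measurable X]setTI; apply: emeasurable_fun_o_infty => //.
  exact: adapted_measurable.
have GE : [set w | exists t, x%:E < X t w] = \bigcup_n G n.
  apply/seteqP; split => w /=.
    by move=> [t xt]; exists t.+1 => //; exists t => /=.
  by move=> [n _ [t _ xt]]; exists t.
have PG n : P (G n) <= (x^-1)%:E.
  have : x%:E * P (G n) <= 1.
    have <- : \int[P]_w (x * \1_(G n) w)%:E = x%:E * P (G n).
      under eq_integral do rewrite EFinM.
      rewrite ge0_integralZl_EFin ?integral_indic ?setIT ?ltW//.
      exact/measurable_EFinP/measurable_indic.
    apply: le_trans (hX (first_crossing X x n) _ _).
    - apply: ge0_le_integral_lower => w _.
        by rewrite lee_fin mulr_ge0// ltW.
      rewrite /stopped/= indicE.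
      have [|_] := boolP (w \in G n); last by rewrite mulr0.
      move=> /set_mem[t /= tn xt]; rewrite mulr1; apply/ltW.
      apply: (@find_iota_lt (fun u => x%:E < X u w) n).
      by rewrite (leq_ltn_trans _ tn)// find_iota_le.
    - exact: stopping_time_first_crossing.
    - rewrite (_ : [set w | _] = setT) ?probability_setT//.
      by apply/seteqP; split.
  by rewrite -[in X in _ -> X](@lee_pmul2l _ x%:E)// -EFinM divff ?gt_eqF.
have Gnd : nondecreasing_seq G.
  move=> m n mn; apply/subsetPset => w [t /= tm xt]; exists t => //=.
  exact: leq_trans mn.
have cvG := nondecreasing_cvg_mu (mu := P) mG (bigcupT_measurable _ mG) Gnd.
rewrite GE -(cvg_lim _ cvG)//.
apply: lime_le; last exact: nearW.
by apply/cvg_ex; eexists; exact: cvG.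
Qed.

End processes.

(** * Adjusted e-processes *)

Section adjusted_process.
Local Open Scope ereal_scope.
Context d (T : measurableType d) (R : realType).
Variables (F : nat -> set (set T)) (A : \bar R -> \bar R).
Hypotheses (hF : filtration F) (hA : adjuster A).
Variables (E : {fset nat} -> nat -> T -> \bar R) (S : {fset nat}).

Lemma adjuster_clamped_ge0 z : 0 <= A (maxe 1 z).
Proof. by have [A0 _ _] := hA; apply: A0; rewrite le_max lexx. Qed.

Lemma adjuster_clamped_nd : {homo (fun z => A (maxe 1 z)) : x y / x <= y}.
Proof.
move=> x y xy; have [_ And _] := hA; apply: And; first by rewrite le_max lexx.
by rewrite ge_max !le_max lexx xy/= orbT.
Qed.

Lemma adjusted_ge0 t w : 0 <= adjusted A E S t w.
Proof. exact: adjuster_clamped_ge0. Qed.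

Lemma time_monotone_adjusted : time_monotone (adjusted A E S).
Proof.
move=> t u w tu; apply: adjuster_clamped_nd; apply: le_ereal_sup.
by move=> _ [s /= st <-]; exists s => //=; exact: leq_trans tu.
Qed.

Lemma adapted_adjusted : adapted F (E S) -> adapted F (adjusted A E S).
Proof.
move=> aE t B mB; rewrite (filtration_measurableE hF) -[X in measurable X]setTI.
have : measurable_fun setT
    (adjusted A E S t : g_sigma_algebraType (F t) -> \bar R).
  apply: (measurableT_comp (nondecreasing_emeasurable adjuster_clamped_nd)).
  by apply: measurable_ereal_sup => u /= ut; exact: adapted_measurable_le.
by move=> /(_ measurableT B mB).
Qed.

(** The bound by [A (1 v sup_t E_t)], which does not depend on the stopping
    time, reduces the claim to Ville's inequality over all times. *)
Lemma e_process_adjusted (H : set (probability T R)) :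
  e_process F H (E S) -> e_process F H (adjusted A E S).
Proof.
move=> [E0 aE hE]; split; [exact: adjusted_ge0|exact: adapted_adjusted|].
move=> P HP tau _ _.
pose Z w := maxe 1 (ereal_sup (range (fun t => E S t w))).
have mZ : measurable_fun setT Z.
  apply: measurable_maxe => //; apply: measurable_ereal_sup => u _.
  exact: (adapted_measurable hF).
have tail (x : R) : (1 <= x)%R -> P [set w | x%:E < Z w] <= (x^-1)%:E.
  move=> x1.
  have x1F : (x%:E < 1) = false by apply/negbTE; rewrite -leNgt lee_fin.
  (* The strict inequality makes the supremum exceed x exactly when some
     term does. *)
  have -> : [set w | x%:E < Z w] = [set w | exists t, x%:E < E S t w].
    apply/seteqP; split => w /=; rewrite /Z lt_max x1F/=.
      by move=> /ereal_sup_gt[_ [t _ <-] xt]; exists t.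
    move=> [t xt]; apply: lt_le_trans xt _.
    by apply: ereal_sup_ubound; exists t.
  by apply: (ville hF aE E0 (hE P HP)); exact: lt_le_trans x1.
have [_ _] := hA; apply: le_trans.
apply: (@le_trans _ _ (\int[P]_w A (maxe 1 (Z w)))).
  apply: ge0_le_integral_lower => w _; rewrite /stopped; case: (tau w) => [t|].
  - exact: adjusted_ge0.
  - by [].
  - rewrite /Z maxA maxxx; apply: adjuster_clamped_nd; apply: le_ereal_sup.
    by move=> _ [s _ <-]; exists s.
  - exact: adjuster_clamped_ge0.
apply: (le_trans (pareto_dominated_integral adjuster_clamped_nd
  adjuster_clamped_ge0 mZ _ tail)); first by move=> w; rewrite /Z le_max lexx.
rewrite le_eqVlt; apply/orP; left; apply/eqP; apply: eq_integral => x.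
by rewrite inE/= in_itv/= andbT => x1; rewrite max_r// lee_fin.
Qed.

End adjusted_process.

(** * Closures of monotone consistent collections *)

Section closures.
Local Open Scope ereal_scope.
Context d (T : measurableType d) (R : realType).
Variables (F : nat -> set (set T)) (I : set nat) (Iact : nat -> {fset nat}).
Hypothesis Iact_mono : forall t u, (t <= u)%N -> (Iact t `<=` Iact u)%fset.
Hypothesis Iact_cover : \bigcup_t [set` Iact t] = I.

Lemma Iact_sub t (S : {fset nat}) : (S `<=` Iact t)%fset -> [set` S] `<=` I.
Proof. by move=> St i /= /(fsubsetP St) it; rewrite -Iact_cover; exists t. Qed.

(** Up to time [t] the processes of [S] and of [S n I_t] coincide, hence so
    do their running maxima. *)
Lemma projectively_consistent_adjusted (A : \bar R -> \bar R)
    (E : {fset nat} -> nat -> T -> \bar R) :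
  filtration F -> adjuster A ->
  projectively_consistent F I Iact E ->
  projectively_consistent F I Iact (adjusted A E).
Proof.
move=> hF hA [aE pE]; split; first exact: adapted_adjusted.
move=> S SI t w; congr (A (maxe _ (ereal_sup _))).
apply: eq_imagel => u /= ut.
rewrite pE// [RHS]pE; last first.
  by move=> i /=; rewrite inE => /andP[iS _]; exact: SI.
by rewrite -fsetIA (fsetIidPr (Iact_mono ut)).
Qed.

Lemma FDP_fsetI (N : set nat) (S Q : {fset nat}) :
  (forall i, i \in Q -> (i \in S) = (i \in N)) -> FDP N Q = FDP [set` S] Q :> R.
Proof.
move=> SN; congr ((#|` _|)%:R / _)%R.
apply/fsetP => i; rewrite !inE/=.
by case: (boolP (i \in Q)) => //= /SN <-; rewrite mem_setE.
Qed.

Lemma FDP_fset0 (Q : {fset nat}) : FDP [set` (fset0 : {fset nat})] Q = 0%R :> R.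
Proof.
rewrite /FDP (_ : [fset i in Q | _]%fset = fset0) ?cardfs0 ?mul0r//.
by apply/fsetP => i; rewrite !inE/= mem_setE inE andbF.
Qed.

Lemma FDP_ge0 (N : set nat) (Q : {fset nat}) : (0 <= FDP N Q :> R)%R.
Proof. by rewrite /FDP divr_ge0. Qed.

Variables (E : {fset nat} -> nat -> T -> \bar R) (alpha : R).
Hypothesis alpha0 : (0 < alpha)%R.
Hypothesis E0 : forall S t w,
  S != fset0 -> (S `<=` Iact t)%fset -> 0 <= E S t w.
Hypothesis Emono : forall S,
  S != fset0 -> [set` S] `<=` I -> time_monotone (E S).
Hypothesis pE : projectively_consistent F I Iact E.

(** The members of [S] outside [I_t] are not rejected, and by consistency they
    do not influence [E^S] at time [t]; so the test against [S] at time [u]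
    follows from the one against [S n I_t] at time [t]. *)
Lemma setwise_persistent_closure :
  setwise_persistent (closure_family alpha Iact E).
Proof.
move=> t u w tu Q [/= Qt hQ]; split.
  exact: fsubset_trans Qt (Iact_mono tu).
move=> S S0 Su; have SI := Iact_sub Su.
rewrite (@FDP_fsetI _ (S `&` Iact t)%fset); last first.
  by move=> i iQ; rewrite mem_setE inE (fsubsetP Qt _ iQ) andbT.
have [->|SIt0] := eqVneq (S `&` Iact t)%fset fset0.
  by rewrite FDP_fset0 mule_ge0 ?lee_fin ?(ltW alpha0)// E0.
apply: le_trans (hQ _ SIt0 (fsubsetIr _ _)) _.
rewrite lee_pmul2l ?lte_fin//; have [_ <-//] := pE.
exact: Emono.
Qed.

(** There are countably many pairs of a time and a rejection set, and for each
    of them [FDP] does not depend on the sample point. *)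
Lemma measurable_sup_FDP (N : set nat) (C : nat -> T -> set {fset nat}) :
  (forall t Q, measurable [set w | C t w Q]) ->
  measurable_fun setT (sup_FDP N C : T -> \bar R).
Proof.
move=> mC mT; apply: (measurability _ (ErealGenOInfty.measurableE R)) => //.
move=> _ [_ [r ->] <-]; rewrite setTI.
rewrite (_ : _ @^-1` _ = \bigcup_t
    \bigcup_(Q in [set Q | (r < FDP N Q :> R)%R]) [set w | C t w Q]).
  apply: bigcupT_measurable => t; rewrite bigcup_mkcond.
  apply: countable_bigcupT_measurable => [|Q]; first exact: countableP.
  by case: ifP.
apply/seteqP; split => w /=; rewrite in_itv/= andbT.
  move=> /ereal_sup_gt[_ [t _ <-]] /ereal_sup_gt[_ [Q CQ <-]] rQ.
  by exists t => //; exists Q.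
move=> [t _ [Q /= rQ CQ]]; apply: (@lt_le_trans _ _ (FDP N Q)%:E) => //.
apply: ereal_sup_ge; exists (ereal_sup [set (FDP N Q)%:E | Q in C t w]).
  by exists t.
by apply: ereal_sup_ubound; exists Q.
Qed.

Lemma measurable_closure_family t Q :
  (forall S, S != fset0 -> (S `<=` Iact t)%fset ->
    measurable_fun setT (E S t)) ->
  measurable [set w | closure_family alpha Iact E t w Q].
Proof.
move=> mE; have [Qt|Qt] := boolP (Q `<=` Iact t)%fset; last first.
  rewrite (_ : [set w | _] = set0)//; apply/seteqP; split => // w [Qt' _].
  by rewrite Qt' in Qt.
rewrite (_ : [set w | _] = ~` \bigcup_(S in [set S : {fset nat} |
    S != fset0 /\ (S `<=` Iact t)%fset])
    [set w | alpha%:E * E S t w < (FDP [set` S] Q)%:E]).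
  apply: measurableC; rewrite bigcup_mkcond.
  apply: countable_bigcupT_measurable => [|S]; first exact: countableP.
  case: ifPn => // /set_mem[/= S0 St].
  rewrite -[X in measurable X]setTI; apply: emeasurable_fun_infty_o => //.
  by apply: measurable_funeM; exact: mE.
apply/seteqP; split => w /=.
  by move=> [_ hQ] [S [S0 St]] /=; rewrite ltNge hQ.
move=> hQ; split => // S S0 St; rewrite leNgt; apply/negP => SQ.
by apply: hQ; exists S.
Qed.

Lemma closure_family_fset0 t w : closure_family alpha Iact E t w fset0.
Proof.
split => [|S S0 St]; first exact: fsub0set.
rewrite /FDP (_ : [fset i in fset0 | _]%fset = fset0).
  by rewrite cardfs0 mul0r mule_ge0 ?lee_fin ?(ltW alpha0)// E0.
by apply/fsetP => i; rewrite !inE.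
Qed.

Section true_null_envelope.
Variables (N : set nat).

Definition active_nulls t : {fset nat} := [fset i in Iact t | i \in N]%fset.

(** The e-value of the intersection of the active true nulls. The value 0
    when there are none matches the vanishing of [FDP] in that case, and keeps
    the bookkeeping process, which may have any sign, out of the bound. *)
Definition null_evidence t w : \bar R :=
  if active_nulls t == fset0 then 0 else E (active_nulls t) t w.

Lemma active_nulls_sub t : (active_nulls t `<=` Iact t)%fset.
Proof. by apply/fsubsetP => i; rewrite !inE => /andP[]. Qed.

Lemma active_nullsI t u : (t <= u)%N ->
  (active_nulls u `&` Iact t)%fset = active_nulls t.
Proof.
move=> tu; apply/fsetP => i; rewrite !inE/= andbC.
case: (boolP (i \in Iact t)) => //= it.
by rewrite (fsubsetP (Iact_mono tu)).
Qed.

Lemma null_evidence_ge0 t w : 0 <= null_evidence t w.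
Proof.
rewrite /null_evidence; case: eqVneq => // N0; apply: E0 => //.
exact: active_nulls_sub.
Qed.

(** The underlying index set changes with [t], so monotonicity in time of each
    single process is not enough: consistency identifies the value at [t] with
    that of the larger index set of a later time. *)
Lemma null_evidence_nd w : nondecreasing_seq (null_evidence ^~ w).
Proof.
move=> t u tu; rewrite [leLHS]/null_evidence.
case: eqVneq => [_|Nt0]; first exact: null_evidence_ge0.
rewrite /null_evidence; case: eqVneq => [Nu0|Nu0].
  by move: Nt0; rewrite -(active_nullsI tu) Nu0 fset0I eqxx.
have NuI := Iact_sub (active_nulls_sub u).
have [_ /(_ _ NuI t w) + ] := pE; rewrite active_nullsI// => <-.
exact: Emono.
Qed.

Lemma FDP_le_null_evidence t w Q : closure_family alpha Iact E t w Q ->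
  (FDP N Q)%:E <= alpha%:E * null_evidence t w.
Proof.
move=> [Qt hQ]; rewrite (@FDP_fsetI _ (active_nulls t)); last first.
  by move=> i iQ; rewrite !inE/= (fsubsetP Qt _ iQ).
rewrite /null_evidence; case: eqVneq => [->|N0].
  by rewrite FDP_fset0 mule0.
by apply: hQ => //; exact: active_nulls_sub.
Qed.

End true_null_envelope.

Lemma stopping_time_cst t : filtration F -> stopping_time F (fun=> Some t).
Proof.
move=> hF u; rewrite (filtration_measurableE hF).
have [tu|ut] := leqP t u.
  rewrite (_ : [set w | _] = setT); first exact: measurableT.
  by apply/seteqP; split => // w _; exists t.
rewrite (_ : [set w | _] = set0); first exact: measurable0.
apply/seteqP; split => // w [s /= su [ts]].
by move: ut; rewrite ts ltnNge su.
Qed.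

(** [SupFDR] is at most [alpha] times the mean of the limit of
    [null_evidence], to which monotone convergence applies. *)
Lemma controls_SupFDR_closure (M : set (probability T R))
    (H : nat -> set (probability T R)) :
  filtration F -> intersection_e_collection F M I H E ->
  controls_SupFDR M I H alpha (closure_family alpha Iact E).
Proof.
move=> hF hE P MP; set N := true_nulls I H P.
have mE S t : S != fset0 -> (S `<=` Iact t)%fset ->
    measurable_fun setT (E S t).
  move=> S0 /Iact_sub SI; have [_ aE _] := hE _ S0 SI.
  exact: (adapted_measurable hF).
split.
  apply: measurable_sup_FDP => t Q.
  by apply: measurable_closure_family => S; exact: mE.
have mf t : measurable_fun setT (null_evidence N t).
  rewrite /null_evidence; case: eqVneq => N0; first exact: measurable_cst.
  by apply: mE => //; exact: active_nulls_sub.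
have f0 t w : setT w -> 0 <= null_evidence N t w.
  by move=> _; exact: null_evidence_ge0.
have intf t : \int[P]_w null_evidence N t w <= 1.
  rewrite /null_evidence; have [N0|N0] := eqVneq (active_nulls N t) fset0.
    by rewrite integral0.
  have [_ _] := hE _ N0 (Iact_sub (active_nulls_sub N t)).
  move=> /(_ P _ (fun=> Some t)); apply.
  - split => // i /=; rewrite !inE => /andP[_ /set_mem[]] //.
  - exact: stopping_time_cst.
  - rewrite (_ : [set w | _] = setT) ?probability_setT//.
    by apply/seteqP; split.
pose g w := limn (null_evidence N ^~ w).
have cvf w := ereal_nondecreasing_cvgn (@null_evidence_nd N w).
have gE w : g w = ereal_sup (range (null_evidence N ^~ w)).
  exact/cvg_lim/cvf.
have fg t w : null_evidence N t w <= g w.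
  by rewrite gE; apply: ereal_sup_ubound; exists t.
have g0 w : 0 <= g w by exact: le_trans (f0 0%N w Logic.I) (fg _ _).
have mg : measurable_fun setT g.
  by rewrite (funext gE); exact: measurable_ereal_sup.
apply: (@le_trans _ _ (\int[P]_w (alpha%:E * g w))).
  apply: ge0_le_integral_lower => w _.
    (* The empty rejection set belongs to the closure, so the inner supremum
       is not -oo. *)
    apply: ereal_sup_ge; exists (ereal_sup
      [set (FDP N Q)%:E | Q in closure_family alpha Iact E 0 w]).
      by exists 0%N.
    apply: (@le_trans _ _ (FDP N fset0)%:E); first by rewrite lee_fin FDP_ge0.
    by apply: ereal_sup_ubound; exists fset0 => //; exact: closure_family_fset0.
  apply: ge_ereal_sup => _ [t _ <-]; apply: ge_ereal_sup => _ [Q CQ <-].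
  apply: le_trans (FDP_le_null_evidence N CQ) _.
  by rewrite lee_pmul2l ?lte_fin.
rewrite ge0_integralZl_EFin ?(ltW alpha0)//.
rewrite -[leRHS]mule1 lee_pmul2l ?lte_fin//.
rewrite monotone_convergence//; last by move=> w _; exact: null_evidence_nd.
apply: lime_le; last exact: nearW.
apply: ereal_nondecreasing_is_cvgn => t u tu.
apply: ge0_le_integral_lower => w _.
  exact: f0.
exact: null_evidence_nd.
Qed.

End closures.

(** * The adjusted collection *)

Theorem proposition4p12 (d : measure_display) (T : measurableType d)
    (R : realType)
    (F : nat -> set (set T)) (hF : filtration F)
    (M : set (probability T R))
    (I : set nat)
    (H : nat -> set (probability T R))
    (hH : forall i, I i -> H i `<=` M)
    (Iact : nat -> {fset nat})
    (hIact_mono : forall t u, (t <= u)%N -> (Iact t `<=` Iact u)%fset)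
    (hIact_cover : \bigcup_t [set` Iact t] = I)
    (A : \bar R -> \bar R) (hA : adjuster A)
    (E : {fset nat} -> nat -> T -> \bar R)
    (hE : intersection_e_collection F M I H E)
    (hE_proj : projectively_consistent F I Iact E) :
  (forall S : {fset nat}, S != fset0 -> [set` S] `<=` I ->
     time_monotone (adjusted A E S) /\
     e_process F (hyp_inter M H S) (adjusted A E S)) /\
  projectively_consistent F I Iact (adjusted A E) /\
  (forall alpha : R, 0 < alpha -> alpha <= 1 ->
     setwise_persistent (closure_family alpha Iact (adjusted A E)) /\
     controls_SupFDR M I H alpha (closure_family alpha Iact (adjusted A E))).
Proof.
have aE : intersection_e_collection F M I H (adjusted A E).
  by move=> S S0 SI; apply: e_process_adjusted => //; exact: hE.
have aP : projectively_consistent F I Iact (adjusted A E).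
  exact: projectively_consistent_adjusted.
have aM S : S != fset0 -> [set` S] `<=` I -> time_monotone (adjusted A E S).
  by move=> _ _; exact: time_monotone_adjusted.
have a0 S t w : S != fset0 -> (S `<=` Iact t)%fset ->
    (0 <= adjusted A E S t w)%E.
  by move=> _ _; exact: adjusted_ge0.
split; first by move=> S S0 SI; split; [exact: aM|exact: aE].
split=> // alpha alpha0 _; split.
  exact: (setwise_persistent_closure hIact_mono hIact_cover alpha0 a0 aM aP).
exact: (controls_SupFDR_closure hIact_mono hIact_cover alpha0 a0 aM aP hF aE).
Qed.
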